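(* Let $N=r+1$, $M_n:=M_{1,n}=\sum_{i=1}^Nx_i^{\,n}\prod_{j\neq i}\frac{x_i}{x_i-x_j}\Gamma_i$ with $(\Gamma_if)(x)=f(\dots,qx_i,\dots)$, and $m(u)=\sum_{n\in\mathbb{Z}}u^nM_n$. For $\alpha\ge1$ and integers $a_1,\dots,a_\alpha$, let $M_{a_1,\dots,a_\alpha}$ be the coefficient of $u_1^{a_1}\cdots u_\alpha^{a_\alpha}$ in $\prod_{1\le i<j\le\alpha}(1-qu_j/u_i)\,m(u_1)\cdots m(u_\alpha)$. Then $$M_{a_1,\dots,a_\alpha}=\sum_{A\in ASM_\alpha}(-q)^{I(A)-N(A)}(1-q)^{N(A)}\prod_{i=1}^{\alpha}M_{a_i+\alpha-i-m_i(A)},$$ where the product is ordered with $i$ increasing from left to right.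
   Context: $ASM_\alpha$ is the set of $\alpha\times\alpha$ alternating sign matrices: matrices with entries in $\{-1,0,1\}$ whose nonzero entries alternate in sign along each row and column and whose row and column sums all equal $1$. For $A\in ASM_\alpha$: $I(A)=\sum_{i>k,\ j<\ell}A_{i,j}A_{k,\ell}$ is its inversion number, $N(A)$ is the number of entries equal to $-1$, and $m_i(A)=(Av)_i$ where $v=(\alpha-1,\alpha-2,\dots,1,0)^t$. The right-hand side is the quantum determinant of the matrix $(M_{a_j+i-j})_{1\le i,j\le\alpha}$. *)

(* Defs.v *)
From HB Require Import structures.
From mathcomp Require Import all_boot all_order all_algebra.
Set Implicit Arguments. Unset Strict Implicit. Unset Printing Implicit Defensive.
Import Order.TTheory GRing.Theory Num.Theory.
Local Open Scope ring_scope.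

Definition qshift (F : fieldType) (n : nat) (q : F) (i : 'I_n) (x : 'rV[F]_n)
  : 'rV[F]_n := \row_k (if k == i then q * x 0 k else x 0 k).

Definition Gamma (F : fieldType) (n : nat) (q : F) (i : 'I_n)
  (f : 'rV[F]_n -> F) : 'rV[F]_n -> F := fun x => f (qshift q i x).

Definition Mop (F : fieldType) (n : nat) (q : F) (m : int)
  (f : 'rV[F]_n -> F) : 'rV[F]_n -> F :=
  fun x => \sum_(i < n) (x 0 i) ^ m
             * (\prod_(j < n | j != i) (x 0 i / (x 0 i - x 0 j)))
             * Gamma q i f x.

Definition Mprod (F : fieldType) (n : nat) (q : F) (cs : seq int)
  (f : 'rV[F]_n -> F) : 'rV[F]_n -> F :=
  foldr (fun c g => Mop q c g) f cs.

Definition ltpairs (al : nat) : {set 'I_al * 'I_al} :=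
  [set p : 'I_al * 'I_al | (p.1 < p.2)%N].

(* exponent of u_k in prod_{(i,j) in S} u_j/u_i *)
Definition expo (al : nat) (S : {set 'I_al * 'I_al}) (k : 'I_al) : int :=
  (#|[set p in S | p.2 == k]|%:Z - #|[set p in S | p.1 == k]|%:Z).

(* M_{a_1,...,a_al}: coefficient of u^a in
   prod_{i<j} (1 - q u_j/u_i) m(u_1)...m(u_al), obtained by expanding the
   product of binomials as a sum over subsets S of the pairs i<j. *)
Definition Mcoef (F : fieldType) (n : nat) (q : F) (al : nat)
  (a : 'I_al -> int) (f : 'rV[F]_n -> F) : 'rV[F]_n -> F :=
  fun x => \sum_(S : {set 'I_al * 'I_al} | S \subset ltpairs al)
             (- q) ^+ #|S| * Mprod q [seq a k - expo S k | k <- enum 'I_al] f x.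

Definition is_asm (al : nat) (A : 'M[int]_al) : bool :=
  [&& [forall i, forall j, A i j \in [:: -1; 0; 1]],
      [forall i, \sum_j A i j == 1],
      [forall j, \sum_i A i j == 1],
      [forall i : 'I_al, forall j : 'I_al, forall k : 'I_al,
         [&& (j < k)%N, A i j != 0, A i k != 0 &
             [forall l : 'I_al, ((j < l)%N && (l < k)%N) ==> (A i l == 0)]]
         ==> (A i k == - A i j)] &
      [forall j : 'I_al, forall i : 'I_al, forall k : 'I_al,
         [&& (i < k)%N, A i j != 0, A k j != 0 &
             [forall l : 'I_al, ((i < l)%N && (l < k)%N) ==> (A l j == 0)]]
         ==> (A k j == - A i j)]].

(* Encoding of {-1,0,1}-valued matrices by 'I_3-valued ones (k |-> k - 1),
   so that ASMs can be summed over a finite type. *)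
Definition sgn3 (k : 'I_3) : int := (nat_of_ord k)%:Z - 1.
Definition asm_of (al : nat) (B : 'M['I_3]_al) : 'M[int]_al := map_mx sgn3 B.

Definition asm_inv (al : nat) (A : 'M[int]_al) : int :=
  \sum_(i < al) \sum_(k < al | (k < i)%N) \sum_(j < al) \sum_(l < al | (j < l)%N)
     A i j * A k l.

Definition asm_neg (al : nat) (A : 'M[int]_al) : nat :=
  #|[set p : 'I_al * 'I_al | A p.1 p.2 == -1]|.

Definition asm_m (al : nat) (A : 'M[int]_al) (i : 'I_al) : int :=
  \sum_(j < al) A i j * ((al.-1 - j)%N)%:Z.

(* Main.v *)
(** Both sides are linear images of Laurent polynomials under
    u^m |-> M_{a_1 - m_1} ... M_{a_al - m_al}, so no relation between the
    operators M_n is needed: the theorem is the lambda-determinant expansion of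
    prod_{i<j} (u_i + lam u_j) over alternating sign matrices, at lam = -q.

    Recording the column partial sums of an ASM after each row gives a path of
    0/1 states from the empty to the full one, and its weight is a product of
    row transfer operators R(u_i).  Let X(x) be the exterior multiplication by
    sum_v x^v e_v.  Then (x - u) R(u) X(x) = (x + lam u) X(x) R(u), and R(u)
    and X(u) agree on the vacuum, hence
      prod_{i<j} (u_i - u_j) R(u_n) ... R(u_1) vac
        = prod_{i<j} (u_i + lam u_j) X(u_1) ... X(u_n) vac.
    For lam = 0 the coefficient of the full state on the left comes from a
    single path, which shows that X(u_1) ... X(u_n) vac has coefficient
    prod_{i<j} (u_i - u_j) there; cancelling it for general lam gives the
    expansion. *)
Require Import Defs.
From HB Require Import structures.
From mathcomp Require Import all_boot all_order all_algebra.
From mathcomp Require Import zify ring mpoly.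
Import Order.TTheory GRing.Theory Num.Theory.
Local Open Scope ring_scope.
Set Implicit Arguments. Unset Strict Implicit. Unset Printing Implicit Defensive.

(** * Row transfer operators and exterior multiplication *)

(* The argument s is the state after the row, f a vector indexed by the states
   before it, h the row prefix sum on entering the current column; the power of
   u counts the columns entered with h = 1.  Column j of an al-column state
   stands for the exterior generator of index al - 1 - j. *)
Fixpoint row_op (R : comNzRingType) (lam u : R) (h : bool)
    (f : seq bool -> R) (s : seq bool) : R :=
  match s with
  | [::] => if h then f [::] else 0
  | c :: s' =>
    let op k b := row_op lam u k (f \o cons b) s' in
    match h, c with
    | false, false => op false false
    | false, true => op true false + op false true
    | true, false => u * (op true false + (1 + lam) * op false true)
    | true, true => lam * u * op true true
    end
  end.

(** Exterior multiplication on the left: moving e_v past an occupied column costs a sign. *)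
Fixpoint wedge_op (R : comNzRingType) (x : R)
    (f : seq bool -> R) (s : seq bool) : R :=
  match s with
  | [::] => 0
  | false :: s' => wedge_op x (f \o cons false) s'
  | true :: s' =>
    x ^+ size s' * f (false :: s') - wedge_op x (f \o cons true) s'
  end.

Lemma eq_row_op (R : comNzRingType) (lam u : R) h f g :
  f =1 g -> row_op lam u h f =1 row_op lam u h g.
Proof.
move=> fg s; elim: s h f g fg => [|c s IH] h f g fg /=; first by rewrite fg.
have E k b : row_op lam u k (f \o cons b) s = row_op lam u k (g \o cons b) s.
  by apply: IH => t /=.
by rewrite !E.
Qed.

Lemma row_opZ (R : comNzRingType) (lam u a : R) h f s :
  row_op lam u h (fun t => a * f t) s = a * row_op lam u h f s.
Proof.
elim: s h f => [|c s IH] h f /=; first by case: h; rewrite ?mulr0.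
have E k b : row_op lam u k ((fun t => a * f t) \o cons b) s
           = a * row_op lam u k (f \o cons b) s by exact: IH.
by case: h; case: c; rewrite !E; ring.
Qed.

Lemma row_opB (R : comNzRingType) (lam u : R) h f g s :
  row_op lam u h (fun t => f t - g t) s
  = row_op lam u h f s - row_op lam u h g s.
Proof.
elim: s h f g => [|c s IH] h f g /=; first by case: h; rewrite ?subr0.
have E k b : row_op lam u k ((fun t => f t - g t) \o cons b) s
  = row_op lam u k (f \o cons b) s - row_op lam u k (g \o cons b) s.
  exact: IH.
by case: h; case: c; rewrite !E; ring.
Qed.

Lemma row_op0 (R : comNzRingType) (lam u : R) h f s :
  f =1 (fun=> 0) -> row_op lam u h f s = 0.
Proof.
move=> f0; have E : f =1 (fun t => 0 * f t) by move=> t; rewrite f0 mul0r.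
by rewrite (eq_row_op lam u h E) row_opZ mul0r.
Qed.

(** A row preserves the length of states, so the power of [x] acts as a constant. *)
Lemma row_op_size (R : comNzRingType) (lam u x : R) h f s :
  row_op lam u h (fun t => x ^+ size t * f t) s
  = x ^+ size s * row_op lam u h f s.
Proof.
elim: s h f => [|c s IH] h f /=; first by case: h; rewrite ?mulr0 ?expr0.
have E k b : row_op lam u k ((fun t => x ^+ size t * f t) \o cons b) s
           = x ^+ (size s).+1 * row_op lam u k (f \o cons b) s.
  rewrite exprS -mulrA -IH -row_opZ.
  by apply: eq_row_op => t /=; rewrite exprS mulrA.
by case: h; case: c; rewrite !E; ring.
Qed.

Lemma eq_wedge_op (R : comNzRingType) (x : R) f g :
  f =1 g -> wedge_op x f =1 wedge_op x g.
Proof.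
move=> fg s; elim: s f g fg => [|[] s IH] f g fg //=.
  by rewrite fg (IH _ (g \o cons true)) // => t /=.
by apply: IH => t /=.
Qed.

Lemma wedge_opZ (R : comNzRingType) (x a : R) f s :
  wedge_op x (fun t => a * f t) s = a * wedge_op x f s.
Proof.
elim: s f => [|[] s IH] f /=; first by rewrite mulr0.
  by rewrite (IH (f \o cons true)); ring.
exact: (IH (f \o cons false)).
Qed.

Lemma wedge_opD (R : comNzRingType) (x : R) f g s :
  wedge_op x (fun t => f t + g t) s = wedge_op x f s + wedge_op x g s.
Proof.
elim: s f g => [|[] s IH] f g /=; first by rewrite addr0.
  by rewrite (IH (f \o cons true) (g \o cons true)); ring.
exact: (IH (f \o cons false) (g \o cons false)).
Qed.

(* The second identity is what the first one needs at a column where the state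
   passes from 0 to 1; together they are stable under adding a column. *)
Lemma row_wedge_op (R : comNzRingType) (lam u x : R) f s :
  (x - u) * row_op lam u false (wedge_op x f) s
    = (x + lam * u) * wedge_op x (row_op lam u false f) s /\
  (x - u) * (row_op lam u true (wedge_op x f) s
             + x ^+ size s * row_op lam u false f s)
    = (x + lam * u) * (x ^+ size s * row_op lam u false f s
                       - wedge_op x (row_op lam u true f) s).
Proof.
elim: s f => [|c s IH] f /=; first by split; ring.
have [A0 B0] := IH (f \o cons false); have [A1 B1] := IH (f \o cons true).
(* [W0] to [R11] peel the first column off each composite, exposing the terms of the induction
   hypotheses. *)
have W0 k : row_op lam u k (wedge_op x f \o cons false) s
          = row_op lam u k (wedge_op x (f \o cons false)) s.
  exact: eq_row_op.
have W1 k : row_op lam u k (wedge_op x f \o cons true) s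
          = x ^+ size s * row_op lam u k (f \o cons false) s
            - row_op lam u k (wedge_op x (f \o cons true)) s.
  by rewrite -row_op_size -row_opB; apply: eq_row_op.
have R00 : wedge_op x (row_op lam u false f \o cons false) s
         = wedge_op x (row_op lam u false (f \o cons false)) s.
  exact: eq_wedge_op.
have R01 : wedge_op x (row_op lam u false f \o cons true) s
         = wedge_op x (row_op lam u true (f \o cons false)) s
           + wedge_op x (row_op lam u false (f \o cons true)) s.
  by rewrite -wedge_opD; apply: eq_wedge_op.
have R10 : wedge_op x (row_op lam u true f \o cons false) s
         = u * (wedge_op x (row_op lam u true (f \o cons false)) s
           + (1 + lam) * wedge_op x (row_op lam u false (f \o cons true)) s).
  by rewrite -(wedge_opZ x (1 + lam)) -wedge_opD -wedge_opZ; apply: eq_wedge_op.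
have R11 : wedge_op x (row_op lam u true f \o cons true) s
         = lam * u * wedge_op x (row_op lam u true (f \o cons true)) s.
  by rewrite -wedge_opZ; apply: eq_wedge_op.
(* An empty column turns the first identity into [A0]. Each other goal is a combination, with
   coefficients [y] and [z], of two of the hypotheses. *)
have comb (a b a' b' e g y z : R) : a = b -> a' = b' ->
    e - g = y * (a - b) + z * (a' - b') -> e = g.
  by move=> -> ->; rewrite !subrr !mulr0 addr0 => /subr0_eq.
case: c; rewrite /= ?W0 ?W1 ?R00 ?R01 ?R10 ?R11 ?exprS; split => //.
- by apply: (comb _ _ _ _ _ _ 1 (-1) B0 A1); ring.
- by apply: (comb _ _ _ _ _ _ (- (lam * u)) 0 B1 A1); ring.
- by apply: (comb _ _ _ _ _ _ u (- ((1 + lam) * u)) B0 A1); ring.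
Qed.

(** * Chains of operators applied to the vacuum *)

Definition vac (R : comNzRingType) (s : seq bool) : R := (~~ has id s)%:R.

(** The head of [us] acts first here, but last in [wedge_chain]. *)
Definition row_chain (R : comNzRingType) (lam : R) (us : seq R) :
    (seq bool -> R) -> seq bool -> R :=
  foldl (fun g u => row_op lam u false g)^~ us.

Definition wedge_chain (R : comNzRingType) : seq R -> seq bool -> R :=
  foldr (@wedge_op R) (@vac R).

(** A Vandermonde product at [lam] = -1, a monomial at [lam] = 0. *)
Definition pair_prod (R : comNzRingType) (lam : R) (u : nat -> R) (k : nat) : R :=
  \prod_(j < k) \prod_(i < j) (u i + lam * u j).

(** Starting from the vacuum, a row can only switch on one column, and it then picks up one [u] for
    each column to the right. *)
Lemma row_op_vac (R : comNzRingType) (lam u : R) s :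
  row_op lam u false (@vac R) s = wedge_op u (@vac R) s /\
  row_op lam u true (@vac R) s = u ^+ size s * vac R s.
Proof.
have F h t : row_op lam u h (@vac R \o cons false) t = row_op lam u h (@vac R) t.
  exact: eq_row_op.
have T h t : row_op lam u h (@vac R \o cons true) t = 0 by exact: row_op0.
have wT t : wedge_op u (@vac R \o cons true) t = 0.
  rewrite (eq_wedge_op u (g := fun t => 0 * vac R t)) ?wedge_opZ ?mul0r // => z.
  by rewrite mul0r.
elim: s => [|c s [IH1 IH2]] /=; first by split; rewrite ?expr0 ?mul1r.
case: c; rewrite !F !T ?wT ?IH1 ?IH2; split.
- by rewrite addr0 subr0.
- by rewrite /vac /= !mulr0.
- by [].
- by rewrite mulr0 addr0 exprS mulrA.
Qed.

(** The row operator is commuted past every factor by [row_wedge_op]; on reaching the vacuum it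
    becomes the last wedge factor. *)
Lemma row_wedge_chain (R : comNzRingType) (lam u : R) us s :
  \prod_(x <- us) (x - u) * row_op lam u false (wedge_chain us) s
  = \prod_(x <- us) (x + lam * u) * wedge_chain (rcons us u) s.
Proof.
elim: us s => [|x us IH] s /=.
  by rewrite !big_nil (row_op_vac _ _ _).1.
rewrite !big_cons mulrAC (row_wedge_op _ _ _ _ _).1 -!mulrA; congr (_ * _).
rewrite mulrC -!wedge_opZ; apply: eq_wedge_op => t; exact: IH.
Qed.

(** Each new row supplies the factors of both pair products that involve its variable. *)
Lemma row_chainE (R : comNzRingType) (lam : R) (u : nat -> R) k s :
  pair_prod (-1) u k * row_chain lam (mkseq u k) (@vac R) s
  = pair_prod lam u k * wedge_chain (mkseq u k) s.
Proof.
elim: k s => [|k IH] s; first by rewrite /pair_prod !big_ord0.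
have prodE a : pair_prod a u k.+1
  = pair_prod a u k * \prod_(x <- mkseq u k) (x + a * u k).
  by rewrite /pair_prod big_ord_recr /= big_map -val_enum_ord big_map big_enum.
rewrite !prodE mkseqS /row_chain -cats1 foldl_cat /= -/(row_chain _ _ _) cats1.
rewrite mulrAC -row_opZ.
rewrite (eq_row_op _ _ _ (IH)) row_opZ -!mulrA; congr (_ * _).
rewrite -row_wedge_chain mulrC; congr (_ * _).
by apply: eq_bigr => x _; rewrite mulN1r.
Qed.

(** At [lam] = 0 a column that stays occupied cannot be entered with prefix sum 1, so the row
    switches on the last occupied column. A later -1 would leave the row sum at 0. *)
Lemma row_op_lam0 (R : comNzRingType) (u : R) f k m :
  row_op 0 u false f (nseq k.+1 true ++ nseq m false)
  = u ^+ m * f (nseq k true ++ nseq m.+1 false).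
Proof.
have F0 g j : row_op 0 u false g (nseq j false) = 0.
  by elim: j g => [|j IH] g //=; rewrite IH.
have T0 g j : row_op 0 u true g (nseq j false) = u ^+ j * g (nseq j false).
  elim: j g => [|j IH] g /=; first by rewrite mul1r.
  by rewrite F0 IH mulr0 addr0 exprS -mulrA.
elim: k f => [|k IH] f.
  by rewrite [LHS]/= F0 T0 addr0.
rewrite (_ : nseq k.+2 true = true :: nseq k.+1 true) //.
by rewrite cat_cons [LHS]/= !mul0r add0r; exact: IH.
Qed.

(** The only surviving path fills the columns from left to right. *)
Lemma row_chain_lam0 (R : comNzRingType) (u : nat -> R) k m :
  row_chain 0 (mkseq u k) (@vac R) (nseq k true ++ nseq m false)
  = \prod_(i < k) u i ^+ (k + m - i.+1).
Proof.
elim: k m => [|k IH] m.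
  by rewrite big_ord0 /row_chain /= /vac has_nseq andbF.
rewrite mkseqS /row_chain -cats1 foldl_cat -/(row_chain _ _ _) [LHS]row_op_lam0.
rewrite -/(row_chain _ _ _ _) IH big_ord_recr /= mulrC addKn; congr (_ * _).
by apply: eq_bigr => i _; rewrite addnS.
Qed.

Lemma row_chain_full (R : idomainType) (lam : R) (u : nat -> R) n :
  (forall i, (i < n)%N -> u i != 0) ->
  (forall i j, (i < j < n)%N -> u i != u j) ->
  row_chain lam (mkseq u n) (@vac R) (nseq n true) = pair_prod lam u n.
Proof.
move=> u0 uI.
have V0 : pair_prod (-1) u n != 0.
  apply/prodf_neq0 => j _; apply/prodf_neq0 => i _.
  by rewrite mulN1r subr_eq0 uI ?ltn_ord.
have P0 : pair_prod 0 u n != 0.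
  apply/prodf_neq0 => j _; apply/prodf_neq0 => i _.
  by rewrite mul0r addr0 u0 // (ltn_trans _ (ltn_ord j)).
have E : \prod_(i < n) u i ^+ (n - i.+1) = pair_prod 0 u n.
  elim: (n) => [|k IH]; first by rewrite /pair_prod !big_ord0.
  rewrite /pair_prod !big_ord_recr /= -/(pair_prod 0 u k) -IH subnn expr0 mulr1.
  rewrite -big_split /=; apply: eq_bigr => i _.
  by rewrite mul0r addr0 -exprSr -subSn.
(* At [lam] = 0 the chain identity yields [W]: the wedge coefficient of the full state is the
   Vandermonde product. *)
have := row_chainE 0 u n (nseq n true ++ nseq 0 false).
rewrite row_chain_lam0 addn0 E [in RHS]cats0 mulrC => /(mulfI P0) W.
by apply: (mulfI V0); rewrite row_chainE -W mulrC.
Qed.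

(** * Matrix coefficients of a row and sums over paths *)

(** Here [t] precedes the row and [s] follows it. The column cases sent to 0 are those where the
    prefix sum would leave {0,1}. *)
Fixpoint row_kernel (R : comNzRingType) (lam u : R) (h : bool)
    (t s : seq bool) : R :=
  match t, s with
  | [::], [::] => h%:R
  | b :: t', c :: s' =>
    match h, b, c with
    | false, false, false => row_kernel lam u false t' s'
    | false, false, true => row_kernel lam u true t' s'
    | false, true, true => row_kernel lam u false t' s'
    | true, false, false => u * row_kernel lam u true t' s'
    | true, true, true => lam * u * row_kernel lam u true t' s'
    | true, true, false => (1 + lam) * u * row_kernel lam u false t' s'
    | _, _, _ => 0
    end
  | _, _ => 0
  end.

Lemma big_tuple_cons (R : nmodType) (T : finType) n (F : n.+1.-tuple T -> R) :
  \sum_t F t = \sum_b \sum_(t : n.-tuple T) F [tuple of b :: t].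
Proof.
rewrite pair_big (reindex (fun p : T * n.-tuple T => [tuple of p.1 :: p.2])) //=.
exists (fun t => (thead t, [tuple of behead t])) => [[b t] _|t _] /=.
  by congr (_, _); apply: val_inj.
by rewrite [in RHS](tuple_eta t).
Qed.

Lemma row_op_kernel (R : comNzRingType) (lam u : R) n h f (s : n.-tuple bool) :
  row_op lam u h f s = \sum_(t : n.-tuple bool) row_kernel lam u h t s * f t.
Proof.
elim: n h f s => [|n IH] h f s.
  rewrite (big_pred1 [tuple]) => [|t]; last by apply/esym/eqP; exact: tuple0.
  by rewrite (tuple0 s) /=; case: h; rewrite ?mul1r ?mul0r.
have [c {}s] := tupleP s.
rewrite big_tuple_cons big_bool /=.
case: h; case: c; rewrite !IH ?mulr_sumr -?big_split /= ?mulr_sumr;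
  by apply: eq_bigr => t _ /=; ring.
Qed.

(** The matrix row between two states has entries s_i - t_i; the offset [h] serves the induction on
    columns. *)
Definition row_prefix (h : int) (t s : seq bool) (j : nat) : int :=
  h + \sum_(i < j) ((nth false s i)%:Z - (nth false t i)%:Z).

Definition row_ok (h : int) (n : nat) (t s : seq bool) : bool :=
  (\big[andb/true]_(j < n.+1) (row_prefix h t s j \in [:: 0; 1]))
  && (row_prefix h t s n == 1).

Definition row_weight (R : comNzRingType) (lam u : R) (h : int) (n : nat)
    (t s : seq bool) : R :=
  \prod_(j < n)
    (lam ^+ [&& row_prefix h t s j == 1, nth false t j & nth false s j]
     * (1 + lam) ^+ (nth false t j && ~~ nth false s j)
     * u ^+ (row_prefix h t s j == 1)).

Lemma row_prefix0 h t s : row_prefix h t s 0 = h.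
Proof. by rewrite /row_prefix big_ord0 addr0. Qed.

Lemma row_prefix_cons h b c t s j :
  row_prefix h (b :: t) (c :: s) j.+1 = row_prefix (h + (c%:Z - b%:Z)) t s j.
Proof. by rewrite /row_prefix big_ord_recl addrA. Qed.

Lemma row_ok_cons h n b c t s :
  row_ok h n.+1 (b :: t) (c :: s)
  = (h \in [:: 0; 1]) && row_ok (h + (c%:Z - b%:Z)) n t s.
Proof.
rewrite /row_ok big_ord_recl row_prefix0 row_prefix_cons -andbA; congr (_ && (_ && _)).
by apply: eq_bigr => j _; rewrite row_prefix_cons.
Qed.

Lemma row_okN h n t s : h \notin [:: 0; 1] -> row_ok h n t s = false.
Proof. by move=> /negbTE hN; rewrite /row_ok big_ord_recl row_prefix0 hN. Qed.

Lemma row_weight_cons (R : comNzRingType) (lam u : R) h n b c t s :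
  row_weight lam u h n.+1 (b :: t) (c :: s)
  = lam ^+ [&& h == 1, b & c] * (1 + lam) ^+ (b && ~~ c) * u ^+ (h == 1)
    * row_weight lam u (h + (c%:Z - b%:Z)) n t s.
Proof.
rewrite /row_weight big_ord_recl row_prefix0; congr (_ * _).
by apply: eq_bigr => j _; rewrite /= row_prefix_cons.
Qed.

Lemma row_kernelE (R : comNzRingType) (lam u : R) n (h : bool)
    (t s : n.-tuple bool) :
  row_kernel lam u h t s
  = (row_ok h n t s)%:R * row_weight lam u h n t s.
Proof.
elim: n h t s => [|n IH] h t s.
  rewrite (tuple0 t) (tuple0 s) /row_weight /row_ok big_ord0.
  by rewrite big_ord_recl big_ord0 row_prefix0; case: h; rewrite ?mulr1.
have [b {}t] := tupleP t; have [c {}s] := tupleP s.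
rewrite row_weight_cons row_ok_cons.
case: h; case: b; case: c => /=; rewrite ?IH;
  by [ring | rewrite row_okN ?mul0r].
Qed.

Lemma row_chain_path (R : comNzRingType) (lam : R) n (x0 : n.-tuple bool) us f
    (s : n.-tuple bool) :
  row_chain lam us f s
  = \sum_(t : n.-tuple bool) f t *
    \sum_(p : (size us).-tuple (n.-tuple bool) | last t p == s)
      \prod_(i < size us)
        row_kernel lam us`_i false (nth x0 (t :: p) i) (nth x0 p i).
Proof.
elim: us f => [|u us IH] f /=.
  rewrite (bigD1 s) //= [X in _ + X]big1 => [|t ts].
    rewrite addr0 (big_pred1 [tuple]) ?big_ord0 ?mulr1 // => p.
    by rewrite (tuple0 p) /= !eqxx.
  by rewrite big_pred0 ?mulr0 // => p; rewrite (tuple0 p) /= (negbTE ts).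
rewrite [LHS]IH /=; under eq_bigr => t' _ do rewrite row_op_kernel mulr_suml.
rewrite exchange_big; apply: eq_bigr => t _ /=.
rewrite [in RHS]big_mkcond big_tuple_cons mulr_sumr; apply: eq_bigr => t' _.
rewrite -big_mkcond /= (mulrC (row_kernel _ _ _ _ _)) -mulrA; congr (_ * _).
by rewrite mulr_sumr; apply: eq_bigr => p _; rewrite big_ord_recl.
Qed.

(** * Alternation of signs in terms of prefix sums *)

Definition prefix_sum (n : nat) (a : 'I_n -> int) (m : nat) : int :=
  \sum_(l < n | (l < m)%N) a l.

(** Same body as the row and column clauses of [is_asm], so that these match by conversion. *)
Definition alternating (n : nat) (a : 'I_n -> int) : bool :=
  [forall j : 'I_n, forall k : 'I_n,
     [&& (j < k)%N, a j != 0, a k != 0 &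
         [forall l : 'I_n, ((j < l)%N && (l < k)%N) ==> (a l == 0)]]
     ==> (a k == - a j)].

Lemma prefix_sum0 n (a : 'I_n -> int) : prefix_sum a 0 = 0.
Proof. exact: big_pred0. Qed.

Lemma prefix_sumS n (a : 'I_n -> int) (j : 'I_n) :
  prefix_sum a j.+1 = prefix_sum a j + a j.
Proof.
rewrite /prefix_sum (bigD1 j) //= addrC; congr (_ + _).
by apply: eq_bigl => l; rewrite ltnS ltn_neqAle andbC.
Qed.

Lemma prefix_sum_full n (a : 'I_n -> int) : prefix_sum a n = \sum_j a j.
Proof. by apply: eq_bigl => j; rewrite ltn_ord. Qed.

Lemma prefix_sum_gap n (a : 'I_n -> int) (j k : 'I_n) :
  (j < k)%N -> (forall l : 'I_n, (j < l < k)%N -> a l = 0) ->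
  prefix_sum a k = prefix_sum a j + a j.
Proof.
move=> jk a0; rewrite -prefix_sumS /prefix_sum (bigID (fun l : 'I_n => (l < j.+1)%N)).
rewrite /= [X in _ + X]big1 ?addr0 => [|l /andP[lk]].
  apply: eq_bigl => l; apply: andb_idl => lj; exact: leq_trans lj jk.
by rewrite -leqNgt => jl; apply: a0; rewrite jl lk.
Qed.

(** Consecutive nonzero entries of equal sign would move the prefix sum by 2. Conversely,
    alternation makes it oscillate between 0 and the first nonzero entry, which the total forces to
    be 1. *)
Lemma alternatingP n (a : 'I_n -> int) :
  (forall j, a j \in [:: -1; 0; 1]) -> \sum_j a j = 1 ->
  reflect (forall m, (m <= n)%N -> prefix_sum a m \in [:: 0; 1]) (alternating a).
Proof.
move=> a3 a1; apply: (iffP idP) => [alt | pre]; last first.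
  apply/forallP => j; apply/forallP => k; apply/implyP.
  move=> /and4P[jk aj ak /forallP a0].
  have E := prefix_sum_gap jk (fun l lP => eqP (implyP (a0 l) lP)).
  have := pre _ (ltnW (ltn_ord j)); have := pre _ (ltnW (ltn_ord k)).
  have := pre _ (ltn_ord k); rewrite prefix_sumS E.
  move: (a3 j) (a3 k) aj ak; rewrite !inE; lia.
have altP (j k : 'I_n) : (j < k)%N -> a j != 0 -> a k != 0 ->
    (forall l : 'I_n, (j < l < k)%N -> a l = 0) -> a k = - a j.
  move=> jk aj ak a0; apply/eqP.
  apply: (implyP (forallP (forallP alt j) k)); apply/and4P; split=> //.
  by apply/forallP => l; apply/implyP => /a0 ->.
(* With c the first nonzero entry, the prefix sums are 0 or c, and the last
   nonzero entry so far determines which. *)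
have inv m : (m <= n)%N ->
    ((forall i, (i <= m)%N -> prefix_sum a i = 0) \/
     exists c (j : 'I_n), [/\ (c == 1) || (c == -1), (j < m)%N,
       forall l : 'I_n, (j < l < m)%N -> a l = 0,
       forall i, (i <= m)%N -> prefix_sum a i = 0 \/ prefix_sum a i = c
     & a j = c /\ prefix_sum a m = c \/ a j = - c /\ prefix_sum a m = 0]).
  elim: m => [_|m IH mn].
    by left=> i; rewrite leqn0 => /eqP ->; exact: prefix_sum0.
  have S := prefix_sumS a (Ordinal mn); rewrite /= in S.
  have := a3 (Ordinal mn); rewrite !inE => am3.
  have [am0|amN0] := eqVneq (a (Ordinal mn)) 0.
    rewrite am0 addr0 in S.
    have [p0|[c [j [cE jm gap pre last]]]] := IH (ltnW mn).
      by left=> i; rewrite leq_eqVlt => /orP[/eqP ->|/p0 //]; rewrite S p0.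
    right; exists c, j; split; rewrite ?S //; first exact: ltnW.
      move=> l /andP[jl]; rewrite ltnS leq_eqVlt => /orP[/eqP lm|lm].
        by rewrite -am0; congr a; apply: val_inj.
      by apply: gap; rewrite jl.
    by move=> i; rewrite leq_eqVlt => /orP[/eqP ->|/pre //]; rewrite S; apply: pre.
  right.
  have [p0|[c [j [cE jm gap pre last]]]] := IH (ltnW mn).
    exists (a (Ordinal mn)), (Ordinal mn); split => //=.
    - by move: am3 amN0; lia.
    - by move=> l; rewrite ltnS; lia.
    - move=> i; rewrite leq_eqVlt => /orP[/eqP ->|im].
        by right; rewrite S p0 // add0r.
      by left; exact: p0.
    by left; rewrite S p0 // add0r.
  have aE : a (Ordinal mn) = - a j by apply: altP => //; move: cE last; lia.
  exists c, (Ordinal mn); split => //=.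
  - by move=> l; rewrite ltnS; lia.
  - move=> i; rewrite leq_eqVlt => /orP[/eqP ->|/pre //].
    by rewrite S aE; move: last; lia.
  by rewrite S aE; move: last; lia.
have [p0 m /p0 -> //|[c [j [cE _ _ pre last]]] m mn] := inv n (leqnn n).
have := pre _ (leqnn n); rewrite prefix_sum_full a1 => c1.
by rewrite !inE; have := pre m mn; move: c1 cE; lia.
Qed.

(** * Paths of states and alternating sign matrices *)

(* State 0 is the empty one; state i.+1 is the i-th entry of p. *)
Definition path_state n (p : n.-tuple (n.-tuple bool)) (i : nat) : n.-tuple bool :=
  nth [tuple of nseq n false] ([tuple of nseq n false] :: p) i.

(** The sum s + ~~ t is the code under [sgn3] of the entry s - t. *)
Definition path_mx n (p : n.-tuple (n.-tuple bool)) : 'M['I_3]_n :=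
  \matrix_(i, j) inord (nth false (path_state p i.+1) j
                        + ~~ nth false (path_state p i) j)%N.

Definition mx_path n (B : 'M['I_3]_n) : n.-tuple (n.-tuple bool) :=
  [tuple [tuple prefix_sum (fun k => asm_of B k j) i.+1 == 1 | j < n] | i < n].

Lemma path_mxE n (p : n.-tuple (n.-tuple bool)) i j :
  asm_of (path_mx p) i j
  = (nth false (path_state p i.+1) j)%:Z - (nth false (path_state p i) j)%:Z.
Proof.
rewrite !mxE /sgn3 inordK; first by case: nth; case: nth.
by case: nth; case: nth.
Qed.

Lemma path_state0 n (p : n.-tuple (n.-tuple bool)) j :
  nth false (path_state p 0) j = false.
Proof. by rewrite nth_nseq if_same. Qed.

Lemma path_stateS n (p : n.-tuple (n.-tuple bool)) (i j : 'I_n) :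
  nth false (path_state p i.+1) j = tnth (tnth p i) j.
Proof. by rewrite !(tnth_nth false) (tnth_nth [tuple of nseq n false]). Qed.

Lemma prefix_sum_col n (p : n.-tuple (n.-tuple bool)) (j : 'I_n) m : (m <= n)%N ->
  prefix_sum (fun k => asm_of (path_mx p) k j) m
  = (nth false (path_state p m) j)%:Z.
Proof.
elim: m => [_|m IH mn]; first by rewrite prefix_sum0 path_state0.
rewrite (prefix_sumS _ (Ordinal mn)) /= IH; last exact: ltnW.
by rewrite path_mxE addrC subrK.
Qed.

Lemma prefix_sum_row n (p : n.-tuple (n.-tuple bool)) (i : 'I_n) m : (m <= n)%N ->
  prefix_sum (asm_of (path_mx p) i) m
  = row_prefix 0 (path_state p i) (path_state p i.+1) m.
Proof.
move=> mn; rewrite /row_prefix add0r.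
rewrite (big_ord_widen n (fun j => (nth false (path_state p i.+1) j)%:Z
  - (nth false (path_state p i) j)%:Z) mn).
by apply: eq_bigr => j _; exact: path_mxE.
Qed.

Lemma path_mxK n : cancel (@path_mx n) (@mx_path n).
Proof.
move=> p; apply: eq_from_tnth => i; apply: eq_from_tnth => j.
rewrite !tnth_mktuple prefix_sum_col ?ltn_ord // path_stateS.
by case: (tnth (tnth p i) j).
Qed.

Lemma asm_of_entry n (B : 'M['I_3]_n) i j : asm_of B i j \in [:: -1; 0; 1].
Proof. by rewrite mxE /sgn3; case: (B i j) => [[|[|[|]]]]. Qed.

Lemma is_asmE n (B : 'M['I_3]_n) (A := asm_of B) :
  is_asm A =
  [&& [forall i, \sum_j A i j == 1], [forall j, \sum_i A i j == 1],
      [forall i, alternating (A i)] & [forall j, alternating (fun i => A i j)]].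
Proof.
rewrite /is_asm (_ : [forall i, forall j, _] = true) //.
by apply/forallP => i; apply/forallP => j; exact: asm_of_entry.
Qed.

(** Column prefix sums of an ASM are 0 or 1, so testing them against 1 loses nothing. *)
Lemma mx_pathK n (B : 'M['I_3]_n) : is_asm (asm_of B) -> path_mx (mx_path B) = B.
Proof.
rewrite is_asmE => /and4P[_ /forallP c1 _ /forallP calt].
have stE m (j : 'I_n) : (m <= n)%N ->
    (nth false (path_state (mx_path B) m) j)%:Z
    = prefix_sum (fun k => asm_of B k j) m.
  case: m => [_|m mn]; first by rewrite path_state0 prefix_sum0.
  have := path_stateS (mx_path B) (Ordinal mn) j; rewrite /= => ->.
  rewrite !tnth_mktuple /=.
  have /alternatingP := calt j.
  move=> /(_ (fun i => asm_of_entry B i j) (eqP (c1 j)) _ mn).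
  by rewrite !inE => /orP[] /eqP ->.
apply/matrixP => i j; apply: val_inj.
have := path_mxE (mx_path B) i j.
rewrite !stE ?ltn_ord //; last exact: ltnW.
by rewrite prefix_sumS addrC addKr !mxE /sgn3 => /addIr [].
Qed.

(** Column prefix sums are the states, already 0 or 1, so the column conditions only ask for a full
    last state; [row_ok] expresses the row conditions. *)
Lemma is_asm_path n (p : n.-tuple (n.-tuple bool)) :
  is_asm (asm_of (path_mx p)) =
  (path_state p n == [tuple of nseq n true])
  && [forall i : 'I_n, row_ok 0 n (path_state p i) (path_state p i.+1)].
Proof.
have okE (i : 'I_n) : row_ok 0 n (path_state p i) (path_state p i.+1) =
    (\sum_j asm_of (path_mx p) i j == 1) && alternating (asm_of (path_mx p) i).
  rewrite /row_ok -prefix_sum_row // prefix_sum_full andbC.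
  have [r1|//] := eqP; rewrite big_andE /=.
  apply/forallP/(alternatingP (asm_of_entry _ i) r1) => [H m mn|H m].
    by rewrite prefix_sum_row //; have := H (Ordinal (mn : (m < n.+1)%N)).
  by rewrite -prefix_sum_row; [apply: H|]; rewrite -ltnS.
rewrite is_asmE; apply/and4P/andP => [[/forallP r1 /forallP c1 /forallP ra ca]|].
  split; last by apply/forallP => i; rewrite okE r1 ra.
  apply/eqP; apply: eq_from_tnth => j; have /eqP := c1 j.
  rewrite -prefix_sum_full prefix_sum_col // !(tnth_nth false) nth_nseq ltn_ord.
  by case: nth.
move=> [/eqP last /forallP ok].
have c1 j : \sum_i asm_of (path_mx p) i j = 1.
  by rewrite -prefix_sum_full prefix_sum_col // last nth_nseq ltn_ord.
split; apply/forallP => i; first by have := ok i; rewrite okE => /andP[].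
- exact/eqP.
- by have := ok i; rewrite okE => /andP[].
apply/(alternatingP (fun k => asm_of_entry _ k i) (c1 i)) => m mn.
by rewrite prefix_sum_col //; case: nth.
Qed.

(** * Inversion number, number of -1 entries and row moments along a path *)

(** For fixed i and l, the sum over k < i and j < l factors. *)
Lemma asm_inv_prefix n (A : 'M[int]_n) :
  asm_inv A = \sum_(i < n) \sum_(l < n)
                prefix_sum (A^~ l) i * prefix_sum (A i) l.
Proof.
apply: eq_bigr => i _; rewrite exchange_big /=.
under eq_bigr => j _ do rewrite exchange_big /=.
rewrite (exchange_big_dep predT) //=; apply: eq_bigr => l _.
rewrite mulr_sumr; apply: eq_bigr => j _.
by rewrite mulr_suml; apply: eq_bigr => k _; rewrite mulrC.
Qed.

(** The weight n - 1 - j counts the columns m > j. *)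
Lemma asm_m_prefix n (A : 'M[int]_n) i :
  asm_m A i = \sum_(m < n) prefix_sum (A i) m.
Proof.
rewrite (exchange_big_dep predT) //=; apply: eq_bigr => j _.
rewrite -(big_geq_mkord _ _ xpredT (fun=> A i j)) sumr_const_nat.
by rewrite -mulr_natr subnS -subn1 subnAC subn1 natz.
Qed.

Lemma asm_neg_path n (p : n.-tuple (n.-tuple bool)) :
  asm_neg (asm_of (path_mx p)) =
  (\sum_(i < n) \sum_(j < n)
     (nth false (path_state p i) j && ~~ nth false (path_state p i.+1) j))%N.
Proof.
rewrite pair_big /= /asm_neg cardsE -sum1_card big_mkcond /=.
apply: eq_bigr => -[i j] _; rewrite unfold_in /= path_mxE.
by case: nth; case: nth.
Qed.

Section PathWeight.
Context (n : nat) (p : n.-tuple (n.-tuple bool)).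
Context (asm_p : is_asm (asm_of (path_mx p))).
Let T i j := nth false (path_state p i) j.
Let hb (i j : nat) := row_prefix 0 (path_state p i) (path_state p i.+1) j == 1.

Lemma row_prefix_path (i j : 'I_n) :
  prefix_sum (asm_of (path_mx p) i) j = (hb i j)%:Z /\
  (T i j && ~~ T i.+1 j ==> hb i j).
Proof.
rewrite prefix_sum_row; last exact: ltnW.
have := asm_p; rewrite is_asm_path => /andP[_ /forallP /(_ i)].
rewrite /row_ok big_andE => /andP[/forallP H _].
have := H (Ordinal (leqW (ltn_ord j))).
have := H (Ordinal (ltn_ord j : (j.+1 < n.+1)%N)) => /=.
have -> : row_prefix 0 (path_state p i) (path_state p i.+1) j.+1
  = row_prefix 0 (path_state p i) (path_state p i.+1) j
    + ((T i.+1 j)%:Z - (T i j)%:Z).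
  by rewrite /row_prefix big_ord_recr addrA.
rewrite /hb; move: (row_prefix _ _ _ _) => h; rewrite !inE.
by case: (T i j); case: (T _ j) => /= H1 /orP[] /eqP hE; move: H1; rewrite hE.
Qed.

(** The inversion number counts cells where both prefix sums are 1. Among them, those emptied by the
    row are exactly the -1 entries. *)
Lemma asm_inv_path :
  asm_inv (asm_of (path_mx p)) - (asm_neg (asm_of (path_mx p)))%:Z
  = (\sum_(i < n) \sum_(j < n) [&& hb i j, T i j & T i.+1 j])%N%:Z.
Proof.
apply/eqP; rewrite subr_eq; apply/eqP.
rewrite asm_neg_path asm_inv_prefix -PoszD -big_split /=.
rewrite (big_morph Posz PoszD (erefl _)); apply: eq_bigr => i _.
rewrite -big_split /= (big_morph Posz PoszD (erefl _)); apply: eq_bigr => j _.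
rewrite prefix_sum_col; last exact: ltnW.
have [-> ] := row_prefix_path i j.
by rewrite -/(T _ _) -/(T _ _); case: (hb i j); case: (T i j); case: (T i.+1 j).
Qed.

Lemma asm_m_path (i : 'I_n) :
  asm_m (asm_of (path_mx p)) i = (\sum_(j < n) hb i j)%N%:Z.
Proof.
rewrite asm_m_prefix (big_morph Posz PoszD (erefl _)); apply: eq_bigr => j _.
exact: (row_prefix_path i j).1.
Qed.

Lemma path_weight (R : comNzRingType) (lam : R) (u : nat -> R)
    (A := asm_of (path_mx p)) :
  \prod_(i < n) row_weight lam (u i) 0 n (path_state p i) (path_state p i.+1)
  = lam ^+ `|asm_inv A - (asm_neg A)%:Z|%N * (1 + lam) ^+ asm_neg A
    * \prod_(i < n) u i ^+ `|asm_m A i|%N.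
Proof.
rewrite asm_inv_path asm_neg_path !absz_nat -!prodrXr -!big_split.
apply: eq_bigr => i _; rewrite asm_m_path absz_nat -!prodrXr -!big_split /=.
by apply: eq_bigr.
Qed.
End PathWeight.

(** Both quantities are counts along a path; this lets absolute values stand in for the integer
    exponents. *)
Lemma asm_statistics_ge0 n (B : 'M['I_3]_n) (A := asm_of B) : is_asm A ->
  0 <= asm_inv A - (asm_neg A)%:Z /\ forall i, 0 <= asm_m A i.
Proof.
rewrite /A => asmB; move: (mx_pathK asmB) (asmB) => <- {}asmB.
by split=> [|i]; [rewrite asm_inv_path | rewrite asm_m_path].
Qed.

(** * The lambda-determinant expansion *)

(** The left side is the coefficient of the full state in the row chain, expanded here over paths
    and reindexed by ASMs. *)
Lemma lambda_determinant (R : idomainType) (lam : R) (u : nat -> R) n :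
  (forall i, (i < n)%N -> u i != 0) ->
  (forall i j, (i < j < n)%N -> u i != u j) ->
  pair_prod lam u n
  = \sum_(B : 'M['I_3]_n | is_asm (asm_of B))
      lam ^+ `|asm_inv (asm_of B) - (asm_neg (asm_of B))%:Z|%N
      * (1 + lam) ^+ asm_neg (asm_of B)
      * \prod_(i < n) u i ^+ `|asm_m (asm_of B) i|%N.
Proof.
move=> u0 uI; rewrite -(row_chain_full lam u0 uI).
have nthE (T : Type) (x : T) s m : size s = m -> last x s = nth x (x :: s) m.
  by move=> <-; exact: last_nth.
have chain us : size us = n -> row_chain lam us (@vac R) (nseq n true) =
    \sum_(p : n.-tuple (n.-tuple bool) | path_state p n == [tuple of nseq n true])
      \prod_(i < n) row_kernel lam us`_i false (path_state p i) (path_state p i.+1).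
  move=> usn; have := row_chain_path lam [tuple of nseq n false] us (@vac R)
    [tuple of nseq n true]; rewrite usn => ->.
  rewrite (bigD1 [tuple of nseq n false]) //= [X in _ + X]big1 => [|t tN].
    rewrite addr0 /vac has_nseq andbF mul1r; apply: eq_bigl => p.
    by rewrite (nthE _ _ _ n (size_tuple p)).
  rewrite /vac (_ : has id t) ?mul0r //; apply: contraNT tN => /hasPn tF.
  apply/eqP/eq_from_tnth => i; rewrite (tnth_nth false t) (tnth_nth false) nth_nseq.
  by rewrite ltn_ord; apply/negbTE/tF/mem_nth; rewrite size_tuple.
rewrite chain ?size_mkseq //.
rewrite [RHS](reindex_onto _ _ (@mx_pathK n)) /=.
under [RHS]eq_bigl => p do rewrite path_mxK eqxx andbT is_asm_path.
rewrite big_mkcondr; apply: eq_bigr => p pn.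
case: ifP => [/forallP ok|/negbT].
  rewrite -path_weight; last by rewrite is_asm_path pn; exact/forallP.
  by apply: eq_bigr => i _; rewrite row_kernelE ok mul1r nth_mkseq.
(* A path that is not an ASM has a forbidden row, whose kernel is 0. *)
rewrite negb_forall => /existsP[i /negbTE okN].
by rewrite (bigD1 i) //= row_kernelE okN !mul0r.
Qed.

(** * From polynomials to products of operators *)

(* Polynomials of bounded degree have finitely many candidate monomials, so the
   linear map sending 'X_[m] to phi m is a finite sum over coefficients. *)
Lemma linear_functional_bound (R : comNzRingType) n k (I : finType) (P : pred I)
    (c : I -> R) (m : I -> 'X_{1..n}) (phi : 'X_{1..n} -> R) :
  (forall i, P i -> (mdeg (m i) < k)%N) ->
  \sum_(i | P i) c i * phi (m i)
  = \sum_(b : 'X_{1..n < k}) (\sum_(i | P i) c i *: 'X_[m i])@_b * phi b.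
Proof.
move=> mk; under [RHS]eq_bigr => b _ do rewrite raddf_sum mulr_suml.
rewrite exchange_big; apply: eq_bigr => i Pi /=.
rewrite (bigD1 (BMultinom (mk i Pi))) //= big1 ?addr0 => [|b bN].
  by rewrite mcoeffZ mcoeffX eqxx mulr1.
rewrite mcoeffZ mcoeffX (_ : (m i == b) = false) ?mulr0 ?mul0r //.
by apply: contraNF bN => /eqP E; apply/eqP/val_inj.
Qed.

(** Equal polynomials have equal images under the linear extension of [phi]. *)
Lemma linear_functional_eq (R : comNzRingType) n (I J : finType)
    (P : pred I) (Q : pred J) (c : I -> R) (d : J -> R)
    (m : I -> 'X_{1..n}) (m' : J -> 'X_{1..n}) (phi : 'X_{1..n} -> R) :
  \sum_(i | P i) c i *: 'X_[R, m i] = \sum_(j | Q j) d j *: 'X_[m' j] ->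
  \sum_(i | P i) c i * phi (m i) = \sum_(j | Q j) d j * phi (m' j).
Proof.
(* A single bound exceeding the degrees of all monomials on both sides. *)
pose k := (\sum_i mdeg (m i) + \sum_j mdeg (m' j)).+1.
rewrite (@linear_functional_bound _ _ k) => [-> |i _].
  rewrite -linear_functional_bound // => j _.
  by rewrite ltnS (bigD1 j) //= addnCA leq_addr.
by rewrite ltnS (bigD1 i) //= -addnA leq_addr.
Qed.

(* The exponent of prod_{i<j} u_i * prod_{(i,j) in S} u_j / u_i. *)
Definition subset_mnm al (S : {set 'I_al * 'I_al}) : 'X_{1..al} :=
  (\sum_(p : 'I_al * 'I_al)
    (if p \in S then U_(p.2) else if (p.1 < p.2)%N then U_(p.1) else 0))%MM.

(** The variable u_k occurs al - k - 1 times in prod_{i<j} u_i, and each pair in [S] trades u_i for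
    u_j. *)
Lemma subset_mnm_expo al (S : {set 'I_al * 'I_al}) k : S \subset ltpairs al ->
  (subset_mnm S k)%:Z = (al - k.+1)%N%:Z + expo S k.
Proof.
move=> /subsetP SL; rewrite /expo addrA; apply/eqP; rewrite eq_sym subr_eq eq_sym.
rewrite -!PoszD eqz_nat; apply/eqP.
have card (B : pred ('I_al * 'I_al)) :
    #|[set p in S | B p]| = (\sum_p ((p \in S) && B p))%N.
  by rewrite cardsE -sum1_card big_mkcond; apply: eq_bigr => p _; rewrite unfold_in; case: ifP.
have -> : (al - k.+1 = \sum_(p : 'I_al * 'I_al) ((p.1 < p.2)%N && (p.1 == k)))%N.
  rewrite -(pair_big predT predT (fun i j : 'I_al => ((i < j)%N && (i == k)) : nat)).
  rewrite (bigD1 k) //= [X in (_ + X)%N]big1 => [|i /negbTE ik]; last first.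
    by apply: big1 => j _; rewrite ik andbF.
  rewrite addn0 -[LHS]muln1 -sum_nat_const_nat (big_geq_mkord _ _ xpredT (fun=> 1%N)).
  by rewrite big_mkcond; apply: eq_bigr => j _; rewrite eqxx andbT /=; case: ifP.
rewrite !card /subset_mnm mnm_sumE -!big_split /=; apply: eq_bigr => p _.
have := SL p; rewrite inE; case: (p \in S) => [-> //|_].
  by rewrite mnm1E addnC.
by case: ifP; rewrite ?mnm1E ?mnm0E addn0.
Qed.

Lemma pair_prod_subset (R : comNzRingType) (lam : R) (al : nat)
    (u : nat -> {mpoly R[al]}) : (forall i : 'I_al, u i = 'X_i) ->
  pair_prod lam%:MP u al
  = \sum_(S : {set 'I_al * 'I_al} | S \subset ltpairs al)
      lam ^+ #|S| *: 'X_[subset_mnm S].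
Proof.
move=> uE.
(* Pairs with i >= j get the factor 0 + 1, so the product runs over all pairs and distributes over
   all subsets; those outside [ltpairs] give 0. *)
transitivity (\prod_(p : 'I_al * 'I_al)
    ((if (p.1 < p.2)%N then lam *: 'X_(p.2) else 0)
     + (if (p.1 < p.2)%N then 'X_(p.1) else 1) : {mpoly R[al]})).
  rewrite -(pair_big predT predT (fun i j : 'I_al =>
    (if (i < j)%N then lam *: 'X_j else 0) + (if (i < j)%N then 'X_i else 1) : {mpoly R[al]})).
  rewrite exchange_big /=; apply: eq_bigr => j _.
  rewrite (big_ord_widen al (fun i => u i + lam%:MP * u j)) ?(ltnW (ltn_ord j)) //.
  rewrite big_mkcond; apply: eq_bigr => i _.
  by rewrite !uE mul_mpolyC; case: ifP; rewrite ?add0r // addrC.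
rewrite bigA_distr [RHS]big_mkcond; apply: eq_bigr => S _.
case: ifP => [/subsetP SL|/negbT /subsetPn[p pS]]; last first.
  by rewrite inE => /negbTE pN; rewrite (bigD1 p) //= pS pN mul0r.
rewrite /subset_mnm (big_morph _ (@mpolyXD al R) (mpolyX0 _ _)).
rewrite -mul_mpolyC rmorphXn /= -prodr_const [in RHS]big_mkcond -big_split /=.
apply: eq_bigr => p _; have := SL p; rewrite inE.
case: (p \in S) => [-> //|_]; first by rewrite mul_mpolyC.
by rewrite mul1r; case: ifP; rewrite ?mpolyX0.
Qed.

Theorem theorem4p6 (F : fieldType) (r : nat) (q : F) (al : nat)
  (a : 'I_al -> int) (f : 'rV[F]_(r.+1) -> F) (x : 'rV[F]_(r.+1)) :
  (0 < al)%N ->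
  q != 0 ->
  (forall i, x 0 i != 0) ->
  (forall i j, i != j -> forall k : int, x 0 i != q ^ k * x 0 j) ->
  Mcoef q a f x =
  \sum_(B : 'M['I_3]_al | is_asm (asm_of B))
     (- q) ^ (asm_inv (asm_of B) - (asm_neg (asm_of B))%:Z)
     * (1 - q) ^+ asm_neg (asm_of B)
     * Mprod q [seq a i + ((al - i.+1)%N)%:Z - asm_m (asm_of B) i
               | i <- enum 'I_al] f x.
Proof.
move=> _ _ _ _.
pose u (i : nat) : {mpoly F[al]} := if insub i is Some o then 'X_o else 1.
have uE (i : 'I_al) : u i = 'X_i by rewrite /u valK.
have u0 i : (i < al)%N -> u i != 0.
  move=> ia; rewrite (uE (Ordinal ia)).
  by apply/eqP => /(congr1 (mcoeff U_(Ordinal ia))) /eqP; rewrite mcoeffX eqxx mcoeff0 oner_eq0.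
have uI i j : (i < j < al)%N -> u i != u j.
  move=> /andP[ij ja]; have ia := ltn_trans ij ja.
  rewrite (uE (Ordinal ia)) (uE (Ordinal ja)); apply/eqP.
  move=> /(congr1 (mcoeff U_(Ordinal ia))) /eqP; rewrite !mcoeffX eqxx eq_mnm1.
  by rewrite -val_eqE /= (gtn_eqF ij) oner_eq0.
(* The shift al - k - 1 undoes the monomial prod_{i<j} u_i that clears denominators. *)
pose phi (m : 'X_{1..al}) : F :=
  Mprod q [seq a k + (al - k.+1)%N%:Z - (m k)%:Z | k <- enum 'I_al] f x.
transitivity (\sum_(S : {set 'I_al * 'I_al} | S \subset ltpairs al)
    (- q) ^+ #|S| * phi (subset_mnm S)).
  apply: eq_bigr => S SL; congr (_ * Mprod _ _ _ _).
  by apply: eq_map => k; rewrite subset_mnm_expo //; ring.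
pose mB (B : 'M['I_3]_al) := [multinom `|asm_m (asm_of B) i|%N | i < al].
pose cB (B : 'M['I_3]_al) : F :=
  (- q) ^+ `|asm_inv (asm_of B) - (asm_neg (asm_of B))%:Z|%N
  * (1 - q) ^+ asm_neg (asm_of B).
transitivity (\sum_(B : 'M['I_3]_al | is_asm (asm_of B)) cB B * phi (mB B)); last first.
  apply: eq_bigr => B /asm_statistics_ge0[Nge0 mge0].
  congr (_ * _); first by rewrite /cB -[in RHS](gez0_abs Nge0).
  congr (Mprod _ _ _ _).
  by apply: eq_map => k; rewrite mnmE gez0_abs.
(* What remains is the lambda-determinant identity at [lam] = -q in [{mpoly F[al]}]. *)
apply: linear_functional_eq.
rewrite -(pair_prod_subset _ uE) lambda_determinant //.
apply: eq_bigr => B _; rewrite mpolyXE_id -mul_mpolyC rmorphM !rmorphXn /=.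
rewrite rmorphB rmorphN rmorph1; congr (_ * _).
by apply: eq_bigr => i _; rewrite mnmE uE.
Qed.
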